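(* Let $d, N \in \mathbb{N}$, let $\varrho : \mathbb{R} \to \mathbb{R}$ be measurable, and let $F : (\mathbb{R}^{d \times d})^N \to \mathbb{R}^{d \times d}$ be measurable and translation equivariant. Let $\Omega_1, \dots, \Omega_N \subset \mathbb{R}$ be measurable, and set $\Omega := \Omega_1^{d \times d} \times \cdots \times \Omega_N^{d \times d} \subset (\mathbb{R}^{d \times d})^N$. Then the following hold for each $p \in (0,\infty]$ and each $\varepsilon \in [0,\infty)$: (1) If there is an FNN $\Phi : (\mathbb{R}^{d\times d})^N \to \mathbb{R}$ (with activation function $\varrho$) with $W \in \mathbb{N}$ active parameters and $L$ layers satisfying $\|\Phi - \pi_0 \circ F\|_{L^p(\Omega)} \leq \varepsilon$, then there is a CNN $\Psi : (\mathbb{R}^{d\times d})^N \to \mathbb{R}^{d \times d}$ (with activation function $\varrho$) with $L$ layers and at most $2W$ active parameters such that $\|\Psi - F\|_{L^p(\Omega)} \leq d^{2/p}\, \varepsilon$ (where $d^{2/\infty} := 1$). (2) If there is a CNN $\Psi : (\mathbb{R}^{d\times d})^N \to \mathbb{R}^{d \times d}$ (with activation function $\varrho$) with $W$ active parameters and $L$ layers satisfying $\|\Psi - F\|_{L^p(\Omega)} \leq \varepsilon$, then there is an FNN $\Phi : (\mathbb{R}^{d\times d})^N \to \mathbb{R}$ (with activation function $\varrho$) with $L$ layers and at most $d^4 W$ active parameters such that $\|\Phi - \pi_0 \circ F\|_{L^p(\Omega)} \leq \varepsilon$.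
   Context: Elements of $\mathbb{R}^{d \times d}$ are indexed by $\{0,\dots,d-1\}^2$, and all index arithmetic is modulo $d$ in each coordinate. For $X, Y \in \mathbb{R}^{d\times d}$ the (circular) convolution is $(X \ast Y)_j := \sum_{i \in \{0,\dots,d-1\}^2} X_i\, Y_{(j-i) \bmod d}$. For $i \in \{0,\dots,d-1\}^2$ the translation is $(S_i X)_j := X_{(j-i) \bmod d}$, and for $X = (X_1,\dots,X_N) \in (\mathbb{R}^{d\times d})^N$, $S_i X := (S_i X_1, \dots, S_i X_N)$. A function $F : (\mathbb{R}^{d\times d})^N \to (\mathbb{R}^{d\times d})^M$ is translation equivariant if $F(S_i X) = S_i[F(X)]$ for all $X$ and all $i \in \{0,\dots,d-1\}^2$. The projection $\pi_0$ takes $X = (X^{(1)},\dots,X^{(M)}) \in (\mathbb{R}^{d\times d})^M$ to $(X^{(1)}_{(0,0)}, \dots, X^{(M)}_{(0,0)}) \in \mathbb{R}^M$; here it is used with $M=1$. An FNN with $L \geq 1$ layers and activation function $\varrho$ on $(\mathbb{R}^{d \times d})^N$ is given by affine-linear maps $V_1 : (\mathbb{R}^{d\times d})^N \to \mathbb{R}^{N_1}$ and $V_\ell : \mathbb{R}^{N_{\ell-1}} \to \mathbb{R}^{N_\ell}$, $2 \leq \ell \leq L$ (all $N_\ell \in \mathbb{N}$), and computes the function $V_L \circ \varrho \circ V_{L-1} \circ \cdots \circ \varrho \circ V_1$, with $\varrho$ applied componentwise (and not applied after the last layer). Its number of active parameters is the total number of nonzero entries of the matrices (with respect to the standard bases)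 and of the bias vectors of $V_1, \dots, V_L$. A CNN with $L \geq 1$ layers and activation function $\varrho$ computes $T_L \circ \varrho \circ T_{L-1} \circ \cdots \circ \varrho \circ T_1$ ($\varrho$ componentwise, not applied after the last layer), where each $T_\ell : (\mathbb{R}^{d\times d})^{C_{\ell-1}} \to (\mathbb{R}^{d\times d})^{C_\ell}$ (with $C_0, \dots, C_L \in \mathbb{N}$ the channel counts; here $C_0 = N$ and $C_L = 1$) is of the following form: there are $k \in \mathbb{N}$, convolution kernels $c_1,\dots,c_k \in \mathbb{R}^{d \times d}$, coefficients $A_{j,(i,m)} \in \mathbb{R}$ and biases $b_j \in \mathbb{R}$ (for $1 \leq j \leq C_\ell$, $1 \leq i \leq k$, $1 \leq m \leq C_{\ell-1}$) such that the $j$-th output channel is $[T_\ell(X)]_j = b_j + \sum_{i=1}^k \sum_{m=1}^{C_{\ell-1}} A_{j,(i,m)}\, (X_m \ast c_i)$, where the scalar $b_j$ is added to every component. The number of active parameters of the CNN is the total number, over all layers, of nonzero entries of the convolution kernels, plus nonzero coefficients $A_{j,(i,m)}$, plus nonzero biases $b_j$. For a measurable function $f : \Omega \to \mathbb{R}^J$ with $J$ finite, $\|f\|_{L^p(\Omega)} := \big\| x \mapsto \|f(x)\|_{\ell^p} \big\|_{L^p(\Omega)}$ (with respect to Lebesgue measure; a quasi-norm for $p<1$). *)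

(* Defs.v *)
From HB Require Import structures.
From mathcomp Require Import all_boot all_order all_algebra.
From mathcomp Require Import all_classical all_reals all_analysis.
From mathcomp Require Import measurable_realfun.

Set Implicit Arguments.
Unset Strict Implicit.
Unset Printing Implicit Defensive.

Import Order.TTheory GRing.Theory Num.Theory.
Import numFieldNormedType.Exports.

Local Open Scope classical_set_scope.
Local Open Scope ring_scope.

HB.instance Definition _ (I : finType) (T : pointedType) :=
  isPointed.Build {ffun I -> T} [ffun=> point].

(* Lebesgue measure on R^I for a finite index set I: the Caratheodory measure
   of the outer measure given by countable covers by half-open boxes.  [None]
   is the empty cell; without it the empty set would have infinite outer
   measure when I is empty. *)
Section LebesgueMeasure.
Context (R : realType) (I : finType).
Local Notation T := {ffun I -> R}.

Definition cell_set (c : option (T * T)) : set T :=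
  if c is Some (a, b) then [set x | forall i, a i < x i <= b i] else set0.

Definition cell_vol (c : option (T * T)) : R :=
  if c is Some (a, b) then \prod_i Num.max 0 (b i - a i) else 0.

Local Open Scope ereal_scope.

Definition cell_cover (A : set T) : set (nat -> option (T * T)) :=
  [set c | A `<=` \bigcup_k cell_set (c k)].

Definition lebesgue_outer (A : set T) : \bar R :=
  ereal_inf [set \sum_(k <oo) (cell_vol (c k))%:E | c in cell_cover A].

Lemma cell_vol_ge0 c : 0 <= (cell_vol c)%:E.
Proof.
rewrite lee_fin; case: c => [[a b]|//=].
by apply: prodr_ge0 => i _; rewrite le_max lexx.
Qed.

Lemma lebesgue_outer_ge0 A : 0 <= lebesgue_outer A.
Proof.
apply: le_ereal_inf_tmp => _ [c _ <-]; apply: nneseries_ge0 => k _ _.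
exact: cell_vol_ge0.
Qed.

Lemma lebesgue_outer0 : lebesgue_outer set0 = 0.
Proof.
apply/eqP; rewrite eq_le lebesgue_outer_ge0 andbT.
apply: ereal_inf_lbound; exists (fun=> None); first by [].
by rewrite eseries0.
Qed.

Lemma le_lebesgue_outer :
  {homo lebesgue_outer : A B / A `<=` B >-> A <= B}.
Proof.
move=> A B AB; apply: ereal_inf_le_tmp => _ [c cB <-]; exists c => //.
exact: subset_trans AB cB.
Qed.

Lemma lebesgue_outer_sigma_subadditive : sigma_subadditive lebesgue_outer.
Proof.
move=> A; have [[i ioo]|] := pselect (exists i, lebesgue_outer (A i) = +oo).
  rewrite (eseries_pinfty _ _ ioo) ?leey// => n _.
  by rewrite -ltNye (lt_le_trans _ (lebesgue_outer_ge0 _)).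
rewrite -forallNE => Aoo.
suff add2e (e : {posnum R}) : lebesgue_outer (\bigcup_n A n) <=
    \sum_(i <oo) lebesgue_outer (A i) + e%:num%:E.
  by apply/lee_addgt0Pr => _/posnumP[].
rewrite (le_trans _ (epsilon_trick _ _ _))//; last first.
  by move=> n; exact: lebesgue_outer_ge0.
pose P n (c : nat -> option (T * T)) := cell_cover (A n) c /\
  \sum_(k <oo) (cell_vol (c k))%:E <=
  lebesgue_outer (A n) + (e%:num / (2 ^ n.+1)%:R)%:E.
have [G PG] : {G : nat -> nat -> option (T * T) & forall n, P n (G n)}.
  apply: (@choice _ _ P) => n; rewrite /P /lebesgue_outer.
  set S := (X in ereal_inf X); move infS : (ereal_inf S) => iS.
  case: iS infS => [r Sr|Soo|Soo].
  - have en1 : (0 < e%:num / (2 ^ n.+1)%:R)%R by [].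
    have /(lb_ereal_inf_adherent en1) : ereal_inf S \is a fin_num by rewrite Sr.
    move=> [x [B AnB muBx] xS].
    by exists B; split => //; rewrite muBx -Sr; exact/ltW.
  - by have := Aoo n; rewrite /lebesgue_outer Soo.
  - suff : lbound S 0 by move/le_ereal_inf_tmp; rewrite Soo.
    by move=> /= _ [B AnB <-]; apply: nneseries_ge0 => *; exact: cell_vol_ge0.
pose v := fun ij => (cell_vol (uncurry G ij))%:E.
have v_ge0 x : 0 <= v x by exact: cell_vol_ge0.
apply: (@le_trans _ _ (\esum_(i in setT) v i)).
  apply: ereal_inf_lbound => /=.
  have /card_esym/ppcard_eqP[f] := card_nat2.
  exists (uncurry G \o f).
    move=> t [i _ /(PG i).1 [j _ Gijt]].
    by exists (f^-1%FUN (i, j)) => //=; rewrite invK ?inE.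
  rewrite -(esum_pred_image v _ xpredT) ?[fun=> _]set_true//.
  by rewrite image_eq.
rewrite (_ : esum _ _ = \sum_(i <oo) \sum_(j <oo ) v (i, j)); last first.
  pose J : nat -> set (nat * nat) := fun i => [set (i, j) | j in setT].
  rewrite (_ : setT = \bigcup_k J k); last first.
    by rewrite predeqE => -[a b]; split => // _; exists a => //; exists b.
  rewrite esum_bigcupT //=; last first.
    apply/trivIsetP => i j _ _ ij.
    rewrite predeqE => -[n m] /=; split => //= -[] [_] _ [<-{n} _].
    by move=> [m' _] [] /esym/eqP; rewrite (negbTE ij).
  rewrite -(image_id [set: nat]) -fun_true esum_pred_image//; last first.
    by move=> n _; exact: esum_ge0.
  apply: eq_eseriesr => /= j _.
  rewrite -(esum_pred_image v (pair j) predT)//=; last first.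
    by move=> ? ? _ _; exact: (@can_inj _ _ _ snd).
  by congr esum; rewrite predeqE => -[a b]; split; move=> [i _ <-]; exists i.
apply: lee_lim.
- apply: is_cvg_nneseries => n *.
  by apply: nneseries_ge0 => m *; exact: v_ge0.
- apply: is_cvg_nneseries => n *; apply: adde_ge0 => //.
  exact: lebesgue_outer_ge0.
- by near=> n; apply: lee_sum => i _; exact: (PG i).2.
Unshelve. all: by end_near. Qed.

HB.instance Definition _ := isOuterMeasure.Build R T lebesgue_outer
  lebesgue_outer0 lebesgue_outer_ge0 le_lebesgue_outer
  lebesgue_outer_sigma_subadditive.

Definition lebesgueType : measurableType lebesgue_outer.-cara :=
  caratheodory_type lebesgue_outer.

Definition lebesgue_ffun : set lebesgueType -> \bar R := lebesgue_outer.

HB.instance Definition _ := isMeasure.Build _ lebesgueType R lebesgue_ffun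
  (@caratheodory_measure0 R T lebesgue_outer)
  (@caratheodory_measure_ge0 R T lebesgue_outer)
  (@caratheodory_measure_sigma_additive R T lebesgue_outer).

Definition borelType : measurableType (sigma_display (range cell_set)) :=
  g_sigma_algebraType (range cell_set).

End LebesgueMeasure.

Section LpNorm.
Context (R : realType) (I : finType).
Implicit Types (p : \bar R) (Omega : set {ffun I -> R}).

(* Only 0 < p <= +oo is meaningful. *)
Definition ell_norm (J : finType) p (v : {ffun J -> R}) : R :=
  match p with
  | r%:E => (\sum_j `|v j| `^ r) `^ r^-1
  | +oo%E => \big[Num.max/0]_j `|v j|
  | -oo%E => 0
  end.

(* Extending |f| by 0 outside Omega does not change the norm over Omega, also
   for p = +oo. *)
Definition Lp_norm p Omega (f : {ffun I -> R} -> R) : \bar R :=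
  ('N[@lebesgue_ffun R I]_p[(fun x => (f x)%:E) \_ Omega])%E.

Definition Lp_norm_vec (J : finType) p Omega
    (f : {ffun I -> R} -> {ffun J -> R}) : \bar R :=
  Lp_norm p Omega (fun x => ell_norm p (f x)).

(* F : R^I -> R^J is Lebesgue measurable: preimages of Borel sets are Lebesgue
   measurable. *)
Definition lebesgue_measurable_fun (J : finType)
    (F : {ffun I -> R} -> {ffun J -> R}) : Prop :=
  measurable_fun [set: lebesgueType R I] (F : lebesgueType R I -> borelType R J).

End LpNorm.

(* The side length is d.+1 throughout, so that pixels form the group
   (Z/(d.+1)Z)^2 and j - i is computed modulo d.+1 in each coordinate. *)
Notation pixel d := ('I_d.+1 * 'I_d.+1)%type.

Notation grid R d := {ffun pixel d -> R}.

(* (R^{d x d})^C, with coordinates indexed by (channel, pixel) *)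
Notation stack R d C := {ffun 'I_C * pixel d -> R}.

Section Images.
Context (R : realType) (d : nat).
Implicit Types (X Y : grid R d) (i : pixel d).

Definition channel C (X : stack R d C) (m : 'I_C) : grid R d :=
  [ffun j : pixel d => X (m, j)].

Definition conv X Y : grid R d := [ffun j : pixel d => \sum_i X i * Y (j - i)].

Definition shift i X : grid R d := [ffun j : pixel d => X (j - i)].

Definition shift_stack C i (X : stack R d C) : stack R d C :=
  [ffun mj => shift i (channel X mj.1) mj.2].

Definition translation_equivariant N (F : stack R d N -> grid R d) : Prop :=
  forall (X : stack R d N) i, F (shift_stack i X) = shift i (F X).

Definition pi0 X : R := X (0, 0).

Definition pixel_box N (Omega : 'I_N -> set R) : set (stack R d N) :=
  [set X | forall m j, Omega m (X (m, j))].

End Images.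

Definition nnz (R : realType) (I : finType) (v : {ffun I -> R}) : nat :=
  #|support v|.

Definition activate (R : realType) (rho : R -> R) (I : finType)
  (x : {ffun I -> R}) : {ffun I -> R} := [ffun i => rho (x i)].

Section FNN.
Context (R : realType).

(* affine-linear map R^I -> R^J, given by its matrix and bias vector *)
Record affine (I J : finType) := Affine {
  aff_weight : {ffun J * I -> R};
  aff_bias : {ffun J -> R} }.

Definition affine_eval I J (V : affine I J) (x : {ffun I -> R}) :
    {ffun J -> R} :=
  [ffun j => \sum_i aff_weight V (j, i) * x i + aff_bias V j].

Definition affine_params I J (V : affine I J) : nat :=
  (nnz (aff_weight V) + nnz (aff_bias V))%N.

(* [fnn I L]: networks with L layers, input R^I and output R.  The successors
   in the layer widths, and in the channel and kernel counts below, encode that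
   these numbers are positive. *)
Inductive fnn (I : finType) : nat -> Type :=
| FnnOut of affine I 'I_1 : fnn I 1
| FnnHidden n L of affine I 'I_n.+1 & fnn 'I_n.+1 L : fnn I L.+1.

Fixpoint fnn_eval (rho : R -> R) I L (Phi : fnn I L) (x : {ffun I -> R}) : R :=
  match Phi with
  | FnnOut V => affine_eval V x ord0
  | FnnHidden _ _ V Phi' => fnn_eval rho Phi' (activate rho (affine_eval V x))
  end.

Fixpoint fnn_params I L (Phi : fnn I L) : nat :=
  match Phi with
  | FnnOut V => affine_params V
  | FnnHidden _ _ V Phi' => (affine_params V + fnn_params Phi')%N
  end.

End FNN.

Section CNN.
Context (R : realType) (d : nat).

Record conv_layer (C C' : nat) := ConvLayer {
  cl_k : nat;
  cl_kernel : {ffun 'I_cl_k.+1 -> grid R d};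
  cl_coef : {ffun 'I_C' * ('I_cl_k.+1 * 'I_C) -> R};
  cl_bias : {ffun 'I_C' -> R} }.

Definition conv_layer_eval C C' (T : conv_layer C C') (X : stack R d C) :
    stack R d C' :=
  [ffun jz : 'I_C' * pixel d => cl_bias T jz.1 +
    \sum_i \sum_m
      cl_coef T (jz.1, (i, m)) * conv (channel X m) (cl_kernel T i) jz.2].

Definition conv_layer_params C C' (T : conv_layer C C') : nat :=
  (\sum_i nnz (cl_kernel T i) + nnz (cl_coef T) + nnz (cl_bias T))%N.

(* [cnn C L]: networks with L layers, C input channels and one output
   channel *)
Inductive cnn (C : nat) : nat -> Type :=
| CnnOut of conv_layer C 1 : cnn C 1
| CnnHidden C' L of conv_layer C C'.+1 & cnn C'.+1 L : cnn C L.+1.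

Fixpoint cnn_eval (rho : R -> R) C L (Psi : cnn C L) (X : stack R d C) :
    grid R d :=
  match Psi with
  | CnnOut T => channel (conv_layer_eval T X) ord0
  | CnnHidden _ _ T Psi' =>
      cnn_eval rho Psi' (activate rho (conv_layer_eval T X))
  end.

Fixpoint cnn_params C L (Psi : cnn C L) : nat :=
  match Psi with
  | CnnOut T => conv_layer_params T
  | CnnHidden _ _ T Psi' => (conv_layer_params T + cnn_params Psi')%N
  end.

End CNN.

(* d ^ (2 / p), with d ^ (2 / +oo) = 1 *)
Definition pow_2_over (R : realType) (d : nat) (p : \bar R) : R :=
  if p is r%:E then d%:R `^ (2 / r) else 1.

(* Main.v *)
Require Import Defs.
From mathcomp Require Import all_boot all_order all_algebra.
From mathcomp Require Import all_classical all_reals all_analysis.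
From mathcomp Require Import measurable_realfun.
From mathcomp Require Import ess_sup_inf lra.

(** A translation equivariant map is determined by its pixel (0,0):
    (F X)_z = pi0 (F (S_{-z} X)). Below, d denotes the side length of the grid,
    which is [d.+1] in the formal text.

    Given an FNN Phi, there is a CNN Psi with (Psi X)_z = Phi (S_{-z} X)
    (lemma [cnn_of_fnn]). Its first layer writes the matrix of the first affine
    map with translations of the input, X_m * delta_{-u} = S_{-u} X_m, one
    kernel per offset u that carries a nonzero weight; its other layers are
    pixelwise and need the single kernel delta_0. There are no more nonzero
    kernel entries than nonzero weights, hence the factor 2. Put
    g = Phi - pi0 o F. Then (Psi X - F X)_z = g (S_{-z} X). Translations permute
    the coordinates, so they preserve Lebesgue measure, and they preserve the
    box Omega. For p finite, the p-th power of the norm of Psi - F is thus d^2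
    times that of g; for p infinite the essential suprema agree
    (lemma [Lp_norm_vec_reindex]). Splitting the integral of a sum uses
    measurability of g on Omega. For this, cells of a cover are cut along
    hyperplanes, which makes coordinate half-spaces Caratheodory measurable,
    and cylinders over null sets are shown to be null.

    Given a CNN Psi, the matrix of each layer is written out in full, keeping
    only pixel (0,0) in the last layer, so that Phi = pi0 o Psi (lemma
    [fnn_of_cnn]). A nonzero coefficient A_{j,(i,m)} contributes to at most d^4
    matrix entries, one for each pair of an output and an input pixel. The
    error bound follows from |v_0| <= |v|_p. *)

Set Implicit Arguments.
Unset Strict Implicit.
Unset Printing Implicit Defensive.

Import Order.TTheory GRing.Theory Num.Theory.
Import numFieldNormedType.Exports.

Local Open Scope classical_set_scope.
Local Open Scope ring_scope.

(** * Measurability of coordinates and boxes *)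

Section Halfspace.
Context (R : realType) (I : finType).
Local Notation T := {ffun I -> R}.

(** The part of a cell where the coordinate [i] is at most [r]. *)
Definition cell_below (i : I) (r : R) (c : option (T * T)) : option (T * T) :=
  if c is Some (a, b) then
    Some (a, [ffun j => if j == i then Num.min r (b j) else b j])
  else None.

(** The part of a cell where the coordinate [i] exceeds [r]. *)
Definition cell_above (i : I) (r : R) (c : option (T * T)) : option (T * T) :=
  if c is Some (a, b) then
    Some ([ffun j => if j == i then Num.max r (a j) else a j], b)
  else None.

Lemma cell_set_below i r c :
  cell_set c `&` [set x : T | x i <= r] `<=` cell_set (cell_below i r c).
Proof.
case: c => [[a b]|] x /=; last by case.
move=> [abx xr] j; rewrite ffunE; have /andP[-> xb] := abx j.
by case: eqP => [->|//]; rewrite le_min xr; case/andP: (abx i) => _ ->.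
Qed.

Lemma cell_set_above i r c :
  cell_set c `&` ~` [set x : T | x i <= r] `<=` cell_set (cell_above i r c).
Proof.
case: c => [[a b]|] x /=; last by case.
move=> [abx /negP]; rewrite -ltNge => xr j; rewrite ffunE.
have /andP[ax ->] := abx j; rewrite andbT.
by case: eqP => [->|//]; rewrite gt_max xr; case/andP: (abx i) => ->.
Qed.

Lemma cell_vol_cut i r (c : option (T * T)) :
  cell_vol (cell_below i r c) + cell_vol (cell_above i r c) = cell_vol c.
Proof.
case: c => [[a b]|] /=; last by rewrite addr0.
rewrite (bigD1 i)//= [X in _ + X](bigD1 i)//= [RHS](bigD1 i)//= !ffunE eqxx.
rewrite (eq_bigr (fun j => Num.max 0 (b j - a j))); last first.
  by move=> j /negbTE ji; rewrite !ffunE ji.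
rewrite [X in _ + _ * X](eq_bigr (fun j => Num.max 0 (b j - a j))); last first.
  by move=> j /negbTE ji; rewrite !ffunE ji.
rewrite -mulrDl; congr (_ * _); rewrite !maxEle !minEle.
by repeat case: ifPn; rewrite -?ltNge => *; lra.
Qed.

Lemma measurable_halfspace i r :
  measurable ([set x | x i <= r] : set (lebesgueType R I)).
Proof.
apply: le_caratheodory_measurable => X; apply: le_ereal_inf_tmp => _ [c cX <-].
rewrite (eq_eseriesr (g := fun k => (cell_vol (cell_below i r (c k)))%:E +
    (cell_vol (cell_above i r (c k)))%:E)%E); last first.
  by move=> k _; rewrite -EFinD cell_vol_cut.
rewrite nneseriesD; do ?by move=> k _ _; exact: cell_vol_ge0.
apply: leeD; apply: ereal_inf_lbound.
- exists (fun k => cell_below i r (c k)) => // x [/cX[k _ ckx] xr].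
  by exists k => //; exact: cell_set_below.
- exists (fun k => cell_above i r (c k)) => // x [/cX[k _ ckx] xr].
  by exists k => //; exact: cell_set_above.
Qed.

End Halfspace.

Lemma measurable_fun_sublevel (R : realType) (d : measure_display)
    (T : measurableType d) (f : T -> R) :
  (forall r, measurable [set x | f x <= r]) -> measurable_fun [set: T] f.
Proof.
move=> mf; apply: (measurability _ (RGenOInfty.measurableE R)) => //.
move=> _ [_ [r ->] <-]; rewrite setTI.
rewrite (_ : _ @^-1` _ = ~` [set x | f x <= r]); first exact: measurableC.
apply/seteqP; split=> x /=; rewrite in_itv/= andbT ltNge; first by move/negP.
by move=> ?; apply/negP.
Qed.

Section Coordinates.
Context (R : realType) (I : finType).
Local Notation T := {ffun I -> R}.

Lemma measurable_coord (i : I) :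
  measurable_fun [set: lebesgueType R I] (fun x : lebesgueType R I => x i : R).
Proof. by apply: measurable_fun_sublevel => r; exact: measurable_halfspace. Qed.

(** Every point lies in one of the countably many cells ]-n, n]^I. *)
Lemma ffun_bounded (x : T) : exists n : nat, forall j, - n%:R < x j <= n%:R.
Proof.
exists (Num.bound (\sum_j `|x j|)) => j.
have xj : `|x j| < (Num.bound (\sum_j `|x j|))%:R.
  apply: le_lt_trans (archi_boundP (sumr_ge0 _ _)) => //.
  by rewrite (bigD1 j)//= lerDl sumr_ge0.
by move: xj; rewrite ltr_norml => /andP[-> /ltW].
Qed.

Lemma measurable_coord_borel (i : I) :
  measurable_fun [set: borelType R I] (fun x : borelType R I => x i : R).
Proof.
apply: measurable_fun_sublevel => r.
rewrite (_ : [set x | _] = \bigcup_n cell_set (Some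
  ([ffun=> - n%:R] : T, [ffun j => if j == i then r else n%:R]))).
  apply: bigcupT_measurable => n; apply: sub_sigma_algebra.
  by eexists; [|reflexivity].
apply/seteqP; split=> x /=.
  move=> xr; have [n xn] := ffun_bounded x; exists n => // j.
  rewrite !ffunE; have /andP[-> xjn] := xn j.
  by case: eqP => [->|].
by case=> n _ /(_ i); rewrite !ffunE eqxx => /andP[].
Qed.

(** A cover of [A] by intervals of total length l gives a cover of the bounded
    part of the cylinder over [A] by cells of total volume (2n)^(#|I| - 1) l. *)
Lemma lebesgue_outer_null_slab (i : I) (A : set R) (n : nat) :
  lebesgue_measure A = 0%E ->
  lebesgue_outer [set x : T | A (x i) /\ forall j, - n%:R < x j <= n%:R] = 0%E.
Proof.
move=> A0; apply/eqP; rewrite eq_le lebesgue_outer_ge0 andbT.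
pose C : R := \prod_(j | j != i) Num.max 0 (n%:R - - n%:R).
have C0 : 0 <= C by apply: prodr_ge0 => j _; rewrite le_max lexx.
apply/lee_addgt0Pr => e e0; rewrite add0e.
(* C may vanish, so the cover is chosen with total length below e / (C + 1). *)
have eC : 0 < e / (C + 1) by rewrite divr_gt0// ltr_wpDl.
have mA0 : mu_ext (wlength (@idfun R)) A = 0%E by rewrite -A0.
have : mu_ext (wlength (@idfun R)) A \is a fin_num by rewrite mA0.
move=> /(lb_ereal_inf_adherent eC)[_ [c [mc Ac] <-]].
rewrite -/(mu_ext (wlength (@idfun R)) A) mA0 add0e => ce.
have /choice[b bE] : forall k, exists b : R * R, c k = `]b.1, b.2]%classic.
  by move=> k; have [b _ <-] := mc k; exists b.
pose c' k := Some ([ffun j => if j == i then (b k).1 else - n%:R] : T,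
  [ffun j => if j == i then (b k).2 else n%:R] : T).
apply: (@le_trans _ _ (\sum_(k <oo) (cell_vol (c' k))%:E)%E).
  apply: ereal_inf_lbound; exists c' => // x [/Ac[k _]]; rewrite bE/= in_itv/=.
  move=> xik xn; exists k => // j; rewrite !ffunE.
  by case: eqP => [->//|_]; exact: xn.
rewrite (eq_eseriesr (g := fun k => (C%:E * wlength idfun (c k))%E));
  last first.
  move=> k _; rewrite bE wlength_itv/= lte_fin (bigD1 i)//= !ffunE eqxx mulrC.
  rewrite (eq_bigr (fun=> Num.max 0 (n%:R - - n%:R))); last first.
    by move=> j /negbTE ji; rewrite !ffunE ji.
  rewrite EFinM -/C; congr (_ * _)%E; case: ifPn => b12.
    by rewrite max_r ?subr_ge0 1?ltW.
  by rewrite max_l// subr_le0 leNgt.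
rewrite nneseriesZl; last by move=> k _; exact: wlength_ge0.
apply: (@le_trans _ _ (C%:E * (e / (C + 1))%:E)%E).
  by apply: lee_wpmul2l => //; exact: ltW.
rewrite -EFinM lee_fin mulrCA ler_piMr// ?(ltW e0)//.
by rewrite ler_pdivrMr ?mul1r ?lerDl// ltr_wpDl.
Qed.

Lemma null_cylinder (i : I) (A : set R) :
  lebesgue_measure A = 0%E -> lebesgue_outer [set x : T | A (x i)] = 0%E.
Proof.
move=> A0; apply/eqP; rewrite eq_le lebesgue_outer_ge0 andbT.
pose B n := [set x : T | A (x i) /\ forall j, - n%:R < x j <= n%:R].
apply: (@le_trans _ _ (lebesgue_outer (\bigcup_n B n))).
  apply: le_lebesgue_outer => x Ax; have [n xn] := ffun_bounded x.
  by exists n.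
apply: le_trans (lebesgue_outer_sigma_subadditive B) _.
by rewrite eseries0// => n _ _; exact: lebesgue_outer_null_slab.
Qed.

(** Lebesgue measure is complete. *)
Lemma lebesgue_outer0_measurable (A : set T) :
  lebesgue_outer A = 0%E -> measurable (A : set (lebesgueType R I)).
Proof.
move=> A0; apply: le_caratheodory_measurable => X.
have XA0 : lebesgue_outer (X `&` A) = 0%E.
  apply/eqP; rewrite eq_le lebesgue_outer_ge0 andbT -A0.
  by apply: le_lebesgue_outer; exact: subIsetr.
rewrite -[X in (X + _)%E]/(lebesgue_outer (X `&` A)) XA0 add0e.
by apply: le_lebesgue_outer; exact: subIsetl.
Qed.

Lemma measurable_cylinder (i : I) (A : set R) :
  completed_algebra_gen (@lebesgue_measure R) A ->
  measurable ([set x | A (x i)] : set (lebesgueType R I)).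
Proof.
case=> B mB [N [N' [mN' N'0 NN']]] <-.
rewrite (_ : [set x | _] = [set x | B (x i)] `|` [set x | N (x i)])//.
apply: measurableU.
  rewrite -[X in measurable X]setTI; exact: (measurable_coord i).
apply: lebesgue_outer0_measurable; apply/eqP.
rewrite eq_le lebesgue_outer_ge0 andbT -(null_cylinder i N'0).
by apply: le_lebesgue_outer => x; exact: NN'.
Qed.

End Coordinates.

Lemma measurable_pixel_box (R : realType) (d N : nat) (Omega : 'I_N -> set R) :
  (forall m, completed_algebra_gen (@lebesgue_measure R) (Omega m)) ->
  measurable
    (pixel_box Omega : set (lebesgueType R ('I_N * pixel d)%type)).
Proof.
move=> mOmega.
rewrite (_ : pixel_box Omega = \bigcap_(mj in [set: 'I_N * pixel d])
  [set x : stack R d N | Omega mj.1 (x mj)]).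
  apply: fin_bigcap_measurable => // mj _.
  exact: measurable_cylinder.
apply/seteqP; split=> [x xO [m j] _|x xO m j]; first exact: (xO m j).
exact: (xO (m, j)).
Qed.

(** * Invariance under permutations of the coordinates *)

(** The map of R^I that permutes the coordinates according to [s]; the
    translations of images are of this form. *)
Definition reindex_ffun (R : Type) (I : finType) (s : I -> I)
  (x : {ffun I -> R}) : {ffun I -> R} := [ffun i => x (s i)].

Lemma reindex_ffunK (R : Type) (I : finType) (s t : I -> I) :
  cancel t s -> cancel (@reindex_ffun R I s) (reindex_ffun t).
Proof. by move=> ts x; apply/ffunP => i; rewrite !ffunE ts. Qed.

(** The preimage of a cell under a permutation of the coordinates is a cell of
    the same volume. *)
Lemma lebesgue_outer_reindex_le (R : realType) (I : finType) (s t : I -> I)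
    (A : set {ffun I -> R}) :
  cancel s t -> cancel t s ->
  (lebesgue_outer (reindex_ffun s @^-1` A) <= lebesgue_outer A)%E.
Proof.
move=> st ts; apply: le_ereal_inf_tmp => _ [c cA <-].
pose c' k := if c k is Some (a, b)
  then Some (reindex_ffun t a, reindex_ffun t b) else None.
rewrite (eq_eseriesr (g := fun k => (cell_vol (c' k))%:E)); last first.
  move=> k _; rewrite /c'; case: (c k) => [[a b]|//] /=.
  rewrite (reindex t); last by exists s => j _; [exact: ts|exact: st].
  by congr EFin; apply: eq_bigr => j _; rewrite !ffunE.
apply: ereal_inf_lbound; exists c' => // x /cA[k _].
rewrite /c' => ckx; exists k => //; move: ckx.
case: (c k) => [[a b]|//] /= abx j.
by have := abx (t j); rewrite !ffunE ts.
Qed.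

Section Reindex.
Context (R : realType) (I : finType) (s t : I -> I).
Context (st : cancel s t) (ts : cancel t s).
Local Notation T := {ffun I -> R}.
Local Notation mu := (@lebesgue_ffun R I).

Lemma lebesgue_outer_reindex (A : set T) :
  lebesgue_outer (reindex_ffun s @^-1` A) = lebesgue_outer A.
Proof.
apply/eqP; rewrite eq_le (lebesgue_outer_reindex_le _ st ts)/=.
rewrite -[X in (lebesgue_outer X <= _)%E](_ :
  reindex_ffun t @^-1` (reindex_ffun s @^-1` A) = A).
  exact: (lebesgue_outer_reindex_le _ ts st).
by rewrite -comp_preimage; apply/seteqP; split=> x /=; rewrite reindex_ffunK.
Qed.

Lemma measurable_reindex :
  measurable_fun [set: lebesgueType R I]
    (reindex_ffun s : lebesgueType R I -> lebesgueType R I).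
Proof.
move=> _ A mA; rewrite setTI.
have cA : caratheodory_measurable (@lebesgue_outer R I) A := mA.
suff : caratheodory_measurable (@lebesgue_outer R I) (reindex_ffun s @^-1` A).
  by [].
move=> X; have XE : X = reindex_ffun s @^-1` (reindex_ffun t @^-1` X).
  by apply/seteqP; split=> x /=; rewrite (reindex_ffunK ts).
rewrite XE preimage_setC -!preimage_setI.
by rewrite !lebesgue_outer_reindex -cA.
Qed.

Lemma ge0_integral_reindex (h : lebesgueType R I -> \bar R) :
  measurable_fun setT h -> (forall x, 0 <= h x)%E ->
  (\int[mu]_x h (reindex_ffun s x) = \int[mu]_x h x)%E.
Proof.
move=> mh h0.
have := @ge0_integral_pushforward _ _ _ _ _ _ measurable_reindex mu setT h
  measurableT mh (fun x _ => h0 x).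
rewrite preimage_setT => <-.
apply: eq_measure_integral => [|mr A _ _]; first exact: measurable_reindex.
exact: lebesgue_outer_reindex.
Qed.

Lemma ae_reindex (P : T -> Prop) :
  (\forall x \ae mu, P x) -> \forall x \ae mu, P (reindex_ffun s x).
Proof.
case=> A [mA A0 PA]; exists (reindex_ffun s @^-1` A); split.
- by rewrite -[X in measurable X]setTI; exact: measurable_reindex.
- exact: etrans (lebesgue_outer_reindex _) A0.
- by move=> x Px; exact: PA.
Qed.

End Reindex.

(** * Counting lemmas *)

Lemma nnzE (R : realType) (I : finType) (v : {ffun I -> R}) :
  nnz v = (\sum_i (v i != 0%R))%N.
Proof.
rewrite /nnz -sum1_card big_mkcond; apply: eq_bigr => i _.
by rewrite inE; case: eqP.
Qed.

Lemma big_pair (A : Type) (idx : A) (op : Monoid.com_law idx) (I J : finType)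
    (F : I * J -> A) :
  \big[op/idx]_p F p = \big[op/idx]_i \big[op/idx]_j F (i, j).
Proof. by rewrite pair_bigA; apply: eq_bigr => -[]. Qed.

Lemma sum_pixel_const (d n : nat) : (\sum_(z : pixel d) n = d.+1 ^ 2 * n)%N.
Proof.
by rewrite big_const iter_addn_0 mulnC card_prod card_ord expnS expn1.
Qed.

Lemma leq_sum_injective (I J : finType) (e : I -> J) (F : J -> nat) :
  injective e -> (\sum_i F (e i) <= \sum_j F j)%N.
Proof.
move=> einj.
rewrite [leqRHS](bigID (fun j => j \in [set e i | i in predT]%SET))/=.
by rewrite big_imset ?leq_addr// => i j _ _; exact: einj.
Qed.

(** Layer widths and kernel counts are successors, so the index set must be
    nonempty. *)
Lemma enum_ordinal (J : finType) (x : J) :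
  exists (n : nat) (e : 'I_n.+1 -> J), bijective e.
Proof.
exists #|J|.-1; have nJ : #|J|.-1.+1 = #|J|.
  by apply: prednK; apply/card_gt0P; exists x.
exists (enum_val \o cast_ord nJ).
apply: bij_comp; first exact: enum_val_bij.
by exists (cast_ord (esym nJ)); [exact: cast_ordK|exact: cast_ordKV].
Qed.

(** * From fully connected to convolutional networks *)

Section FullyConnectedToConvolutional.
Context (R : realType) (d : nat).

(** The Dirac kernel at [u], replaced by the zero kernel when [b] is false: a
    kernel whose coefficients all vanish must not count as a parameter. *)
Definition delta_grid (b : bool) (u : pixel d) : grid R d :=
  [ffun z => (b && (z == u))%:R].

Lemma nnz_delta_grid b u : nnz (delta_grid b u) = b.
Proof.
rewrite nnzE (bigD1 u)//= big1 => [|z /negbTE zu];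
  rewrite ffunE ?zu ?andbF ?eqxx//.
by rewrite andbT addn0; case: b; rewrite ?oner_eq0 ?eqxx.
Qed.

Lemma conv_delta_grid (X : grid R d) b u z :
  Defs.conv X (delta_grid b u) z = b%:R * X (z - u).
Proof.
rewrite ffunE (bigD1 (z - u))//= big1 => [|y yzu]; rewrite ffunE.
  by rewrite subKr eqxx andbT addr0 mulrC.
rewrite (_ : (z - y == u) = false) ?andbF ?mulr0//.
by apply: contraNF yzu => /eqP <-; rewrite subKr.
Qed.

(** A convolutional layer can evaluate an affine map at all translates of its
    input. *)
Lemma sliding_layer N n (V : affine R ('I_N * pixel d)%type 'I_n) :
  exists T : conv_layer R d N n,
    (conv_layer_params T <= 2 * affine_params V)%N /\
    forall X z j, conv_layer_eval T X (j, z) =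
                  affine_eval V (shift_stack (- z) X) j.
Proof.
have [k [u u_bij]] := enum_ordinal (0 : pixel d).
(* Offset u i is used if some weight reads the input there; reading X at z + u i
   means convolving with the Dirac kernel at - u i. *)
pose used i := [exists j, exists m, aff_weight V (j, (m, u i)) != 0].
exists (@ConvLayer R d N n k [ffun i => delta_grid (used i) (- u i)]
  [ffun jim => aff_weight V (jim.1, (jim.2.2, u jim.2.1))] (aff_bias V)); split.
  rewrite /conv_layer_params /affine_params /= mulnDr.
  apply: leq_add; last by rewrite mul2n -addnn leq_addr.
  have wE : nnz (aff_weight V) =
      (\sum_(i < k.+1) \sum_j \sum_m (aff_weight V (j, (m, u i)) != 0%R))%N.
    rewrite nnzE big_pair/=.
    rewrite [RHS]exchange_big; apply: eq_bigr => j _.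
    by rewrite big_pair exchange_big (reindex u)//; exact: onW_bij.
  rewrite mul2n -addnn; apply: leq_add.
    rewrite wE; apply: leq_sum => i _; rewrite ffunE nnz_delta_grid.
    rewrite /used; case: existsP => //= -[j /existsP[m wjm]].
    by rewrite (bigD1 j)//= (bigD1 m)//= wjm.
  rewrite wE nnzE big_pair/=.
  rewrite [leqRHS]exchange_big/=; apply: leq_sum => j _.
  rewrite big_pair/=.
  by apply: leq_sum => i _; apply: leq_sum => m _; rewrite ffunE.
move=> X z j; rewrite !ffunE/= addrC; congr (_ + _).
rewrite big_pair/= exchange_big/=.
apply: eq_bigr => m _; rewrite [RHS](reindex u); last exact: onW_bij.
apply: eq_bigr => i _; rewrite [[ffun i => delta_grid (used i) (- u i)] i]ffunE.
rewrite conv_delta_grid !ffunE/= !opprK.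
rewrite (addrC z); case: (boolP (used i)) => [_|]; first by rewrite mul1r.
rewrite /used negb_exists => /forallP/(_ j); rewrite negb_exists.
by move=> /forallP/(_ m); rewrite negbK => /eqP ->; rewrite !mul0r.
Qed.

(** A convolutional layer with the single kernel delta_0 applies an affine map
    to the channels at each pixel. *)
Lemma pointwise_layer C C' (V : affine R 'I_C 'I_C') :
  exists T : conv_layer R d C C',
    (conv_layer_params T <= 2 * affine_params V)%N /\
    forall X z j, conv_layer_eval T X (j, z) =
                  affine_eval V [ffun m => X (m, z)] j.
Proof.
pose used := [exists jm, aff_weight V jm != 0].
exists (@ConvLayer R d C C' 0 [ffun=> delta_grid used 0]
  [ffun jim => aff_weight V (jim.1, jim.2.2)] (aff_bias V)); split.
  rewrite /conv_layer_params /affine_params /= mulnDr.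
  apply: leq_add; last by rewrite mul2n -addnn leq_addr.
  rewrite mul2n -addnn; apply: leq_add.
    rewrite big_ord1 ffunE nnz_delta_grid nnzE /used.
    case: existsP => //= -[jm w]; by rewrite (bigD1 jm)//= w.
  rewrite !nnzE big_pair/=.
  rewrite big_pair/=.
  apply: leq_sum => j _.
  rewrite big_pair/= big_ord1.
  by apply: leq_sum => m _; rewrite ffunE.
move=> X z j; rewrite !ffunE/= addrC big_ord1; congr (_ + _).
apply: eq_bigr => m _; rewrite [[ffun=> delta_grid used 0] ord0]ffunE.
rewrite conv_delta_grid !ffunE/= subr0.
case: (boolP used) => [_|]; first by rewrite mul1r.
rewrite /used negb_exists => /forallP/(_ (j, m)); rewrite negbK => /eqP ->.
by rewrite !mul0r.
Qed.

(** [view X z] is the input that the copy of the FNN at pixel [z] reads off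
    [X]. In the induction on the layers it is the translate of [X] for the first
    layer, and the vector of channels at [z] for the others. *)
Lemma cnn_of_fnn_view (rho : R -> R) I L (Phi : fnn R I L) C
    (view : stack R d C -> pixel d -> {ffun I -> R}) :
  (forall n (V : affine R I 'I_n), exists T : conv_layer R d C n,
    (conv_layer_params T <= 2 * affine_params V)%N /\
    forall X z j, conv_layer_eval T X (j, z) = affine_eval V (view X z) j) ->
  exists Psi : cnn R d C L, (cnn_params Psi <= 2 * fnn_params Phi)%N /\
    forall X z, cnn_eval rho Psi X z = fnn_eval rho Phi (view X z).
Proof.
elim: Phi C view => [{}I V|{}I n {}L V Phi IH] C view viewP.
  have [T [Tn TE]] := viewP _ V; exists (CnnOut T); split=> // X z /=.
  by rewrite ffunE TE.
have [T [Tn TE]] := viewP _ V.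
have [Psi [Psin PsiE]] := IH n.+1 _ (@pointwise_layer n.+1).
exists (CnnHidden T Psi); split=> [|X z] /=.
  by rewrite mulnDr; exact: leq_add.
rewrite PsiE; congr fnn_eval; apply/ffunP => j.
by rewrite ffunE [LHS]ffunE [RHS]ffunE TE.
Qed.

Lemma cnn_of_fnn (rho : R -> R) N L (Phi : fnn R ('I_N * pixel d)%type L) :
  exists Psi : cnn R d N L, (cnn_params Psi <= 2 * fnn_params Phi)%N /\
    forall X z,
      cnn_eval rho Psi X z = fnn_eval rho Phi (shift_stack (- z) X).
Proof.
apply: (@cnn_of_fnn_view rho _ L Phi N (fun X z => shift_stack (- z) X)).
move=> n V; exact: sliding_layer.
Qed.

End FullyConnectedToConvolutional.

(** * From convolutional to fully connected networks *)

Section ConvolutionalToFullyConnected.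
Context (R : realType) (d : nat).

(** A convolutional layer as an affine map. The indexing [f] numbers the source
    coordinates; [e] selects the target coordinates, all of them for a hidden
    layer, only pixel (0,0) for the last one. *)
Lemma affine_of_conv_layer C C' (T : conv_layer R d C C') (I K : finType)
    (f : I -> 'I_C * pixel d) (e : K -> 'I_C' * pixel d) :
  bijective f -> injective e ->
  exists V : affine R I K,
    (affine_params V <= d.+1 ^ 4 * conv_layer_params T)%N /\
    forall (X : stack R d C) k,
      affine_eval V [ffun i => X (f i)] k = conv_layer_eval T X (e k).
Proof.
move=> f_bij e_inj.
pose M jz my :=
  \sum_i cl_coef T (jz.1, (i, my.1)) * cl_kernel T i (jz.2 - my.2).
exists (Affine [ffun ki => M (e ki.1) (f ki.2)] [ffun k => cl_bias T (e k).1]).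
split.
  rewrite /affine_params /conv_layer_params /= mulnDr mulnDr -addnA.
  apply: (leq_trans _ (leq_addl _ _)); apply: leq_add.
    rewrite [leqLHS]nnzE (eq_bigr (fun ki => (M (e ki.1) (f ki.2) != 0) : nat)).
      apply: (leq_trans (leq_sum_injective
        (e := fun ki : K * I => (e ki.1, f ki.2))
        (fun p => (M p.1 p.2 != 0) : nat) _)).
        by move=> [k i] [k' i'] [/e_inj -> /(bij_inj f_bij) ->].
      (* M (j, z) (m, y) can only be nonzero if some coefficient (j, (i, m))
         is; z and y each range over the d.+1 ^ 2 pixels. *)
      rewrite big_pair nnzE [leqLHS]big_pair.
      rewrite [X in (_ * X)%N]big_pair big_distrr/=.
      apply: leq_sum => j _; rewrite (expnD _ 2 2) -mulnA -sum_pixel_const.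
      apply: leq_sum => z _.
      rewrite big_pair [X in (_ * X)%N]big_pair [X in (_ * X)%N]exchange_big/=.
      rewrite big_distrr; apply: leq_sum => m _.
      rewrite -[leqRHS]sum_pixel_const; apply: leq_sum => y _.
      case: (M (j, z) (m, y) =P 0) => // /eqP; apply: contraNleq.
      rewrite ltnS leqn0 => /eqP/eqP.
      rewrite sum_nat_eq0 => /forallP c0; apply/eqP; rewrite /M big1// => i _.
      by have := c0 i; rewrite implyTb eqb0 negbK => /eqP ->; rewrite mul0r.
    by move=> ki _; rewrite ffunE.
  rewrite [leqLHS]nnzE (eq_bigr (fun k => (cl_bias T (e k).1 != 0) : nat)).
    apply: (leq_trans (leq_sum_injective (fun p => (cl_bias T p.1 != 0) : nat)
      e_inj)).
    rewrite big_pair nnzE big_distrr/=; apply: leq_sum => j _.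
    by rewrite sum_pixel_const leq_mul2r leq_pexp2l ?orbT.
  by move=> k _; rewrite ffunE.
move=> X k; rewrite !ffunE/= addrC; congr (_ + _).
transitivity (\sum_my M (e k) my * X my).
  rewrite [RHS](reindex f); last exact: onW_bij.
  by apply: eq_bigr => i _; rewrite !ffunE.
rewrite big_pair/= [RHS]exchange_big/=; apply: eq_bigr => m _.
rewrite /M; under eq_bigr do rewrite mulr_suml.
rewrite exchange_big/=; apply: eq_bigr => i _.
rewrite ffunE mulr_sumr; apply: eq_bigr => y _.
by rewrite ffunE -mulrA (mulrC (X _)).
Qed.

Lemma fnn_of_cnn_reindex (rho : R -> R) C L (Psi : cnn R d C L) (I : finType)
    (f : I -> 'I_C * pixel d) : bijective f ->
  exists Phi : fnn R I L, (fnn_params Phi <= d.+1 ^ 4 * cnn_params Psi)%N /\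
    forall X : stack R d C,
      fnn_eval rho Phi [ffun i => X (f i)] = pi0 (cnn_eval rho Psi X).
Proof.
elim: Psi I f => [{}C T|{}C C' {}L T Psi IH] I f f_bij.
  have e_inj : injective (fun j : 'I_1 => (j, 0 : pixel d)) by move=> i j [].
  have [V [Vn VE]] := affine_of_conv_layer T f_bij e_inj.
  by exists (FnnOut V); split=> // X /=; rewrite VE /pi0 [RHS]ffunE.
have [n [e e_bij]] := enum_ordinal ((ord0, 0) : 'I_C'.+1 * pixel d).
have [V [Vn VE]] := affine_of_conv_layer T f_bij (bij_inj e_bij).
have [Phi [Phin PhiE]] := IH _ e e_bij.
exists (FnnHidden V Phi); split=> [|X] /=.
  by rewrite mulnDr; exact: leq_add.
rewrite -PhiE; congr fnn_eval; apply/ffunP => k.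
by rewrite [LHS]ffunE [RHS]ffunE [RHS]ffunE VE.
Qed.

Lemma fnn_of_cnn (rho : R -> R) C L (Psi : cnn R d C L) :
  exists Phi : fnn R ('I_C * pixel d)%type L,
    (fnn_params Phi <= d.+1 ^ 4 * cnn_params Psi)%N /\
    forall X, fnn_eval rho Phi X = pi0 (cnn_eval rho Psi X).
Proof.
have id_bij : bijective (@id ('I_C * pixel d)) by exists id.
have [Phi [Phin PhiE]] := fnn_of_cnn_reindex rho Psi id_bij.
exists Phi; split=> // X; rewrite -PhiE; congr fnn_eval.
by apply/ffunP => i; rewrite ffunE.
Qed.

End ConvolutionalToFullyConnected.

(** * Measurability and norms of the errors *)

Lemma measurable_fnn_eval (R : realType) (rho : R -> R)
    (d : measure_display) (T : measurableType d) (I : finType) (L : nat)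
    (Phi : fnn R I L) (x : T -> {ffun I -> R}) :
  measurable_fun [set: R] rho ->
  (forall i, measurable_fun [set: T] (fun t => x t i)) ->
  measurable_fun [set: T] (fun t => fnn_eval rho Phi (x t)).
Proof.
move=> mrho; have maff J K (V : affine R J K) (y : T -> {ffun J -> R}) k :
    (forall i, measurable_fun [set: T] (fun t => y t i)) ->
    measurable_fun [set: T] (fun t => affine_eval V (y t) k).
  move=> my; under eq_fun do rewrite ffunE.
  apply: measurable_funD => //; apply: measurable_sum => i.
  exact: measurable_funM.
elim: Phi x => [{}I V|{}I n {}L V Phi IH] x mx /=; first exact: maff.
apply: IH => k; under eq_fun do rewrite ffunE.
by apply: measurableT_comp => //; exact: maff.
Qed.

Local Open Scope ereal_scope.

(** Monotonicity needs no measurability, since the integral of a nonnegative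
    function is a supremum over the simple functions below it. *)
Lemma le_integral_ge0 (d : measure_display) (T : measurableType d)
    (R : realType) (mu : {measure set T -> \bar R}) (f g : T -> \bar R) :
  (forall x, 0 <= f x) -> (forall x, f x <= g x) ->
  \int[mu]_x f x <= \int[mu]_x g x.
Proof.
move=> f0 fg; have g0 x : 0 <= g x by exact: le_trans (fg x).
rewrite !ge0_integralTE//; apply: le_ereal_sup => _ [h hf <-].
by exists h => // x; exact: le_trans (fg x).
Qed.

Lemma le_poweR (R : realType) (r : R) (x y : \bar R) :
  (0 <= r)%R -> 0 <= x -> x <= y -> x `^ r <= y `^ r.
Proof.
move=> r0 x0 xy; apply: gt0_ler_poweR => //.
  by rewrite itv_boundlr !bnd_simp x0 leey.
by rewrite itv_boundlr !bnd_simp leey (le_trans x0 xy).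
Qed.

Section LpNormLemmas.
Context (R : realType) (I : finType).
Local Notation T := {ffun I -> R}.
Implicit Types (Om : set T) (p : \bar R).

Lemma le_Lp_norm p Om (f g : T -> R) : 0 < p ->
  (forall x, (`|f x| <= `|g x|)%R) -> Lp_norm p Om f <= Lp_norm p Om g.
Proof.
move=> p0 fg; have fgO x :
    `|((fun x => (f x)%:E) \_ Om) x| <= `|((fun x => (g x)%:E) \_ Om) x|.
  by rewrite /patch; case: ifP; rewrite // lee_fin.
rewrite /Lp_norm unlock; case: p p0 => [r|_|//].
  rewrite lte_fin => r0; apply: le_poweR; first by rewrite invr_ge0 ltW.
    by apply: integral_ge0 => x _; exact: poweR_ge0.
  apply: le_integral_ge0 => x; first exact: poweR_ge0.
  by apply: le_poweR; rewrite ?abse_ge0 ?(ltW r0).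
by case: ifP => // _; apply: le_ess_sup; apply: nearW.
Qed.

Lemma ell_norm_ge0 (J : finType) p (v : {ffun J -> R}) : (0 <= ell_norm p v)%R.
Proof.
case: p => [r||] //=; first exact: powR_ge0.
by elim/big_ind: _ => // x y x0 y0; rewrite le_max x0.
Qed.

Lemma ler_ell_norm (J : finType) p (v : {ffun J -> R}) j : 0 < p ->
  (`|v j| <= ell_norm p v)%R.
Proof.
case: p => [r|_|//] /=; last exact: le_bigmax.
rewrite lte_fin => r0; have r_neq0 : r != 0%R by rewrite gt_eqF.
have vE : (`|v j| = (`|v j| `^ r) `^ r^-1)%R.
  by rewrite -powRrM mulfV// powRr1.
rewrite vE; apply: ge0_ler_powR;
  rewrite ?nnegrE ?powR_ge0 ?invr_ge0 ?(ltW r0)//.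
  by apply: sumr_ge0 => i _; exact: powR_ge0.
by rewrite (bigD1 j)//= lerDl; apply: sumr_ge0 => i _; exact: powR_ge0.
Qed.

(** If the components of a vector-valued map are the composites of one function
    [g] with permutations of the coordinates that preserve the domain, then its
    norm is at most #|J|^(1/p) times that of [g]. *)
Lemma Lp_norm_vec_reindex (J : finType) (s t : J -> I -> I) p Om (g : T -> R)
    (eps : R) :
  (forall z, cancel (s z) (t z)) -> (forall z, cancel (t z) (s z)) ->
  0 < p -> measurable (Om : set (lebesgueType R I)) ->
  (forall z x, Om (reindex_ffun (s z) x) <-> Om x) ->
  measurable_fun [set: lebesgueType R I] (g : lebesgueType R I -> R) ->
  (0 <= eps)%R -> Lp_norm p Om g <= eps%:E ->
  Lp_norm_vec p Om (fun x => [ffun z => g (reindex_ffun (s z) x)]) <=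
    ((if p is r%:E then #|J|%:R `^ r^-1 else 1) * eps)%:E.
Proof.
move=> st ts p0 mOm Om_s mg eps0.
rewrite /Lp_norm_vec /Lp_norm unlock; case: p p0 => [r|_|//]; last first.
  rewrite mul1r; case: ifP => // _ /ess_supP geps; apply/ess_supP.
  have : \forall x \ae @lebesgue_ffun R I, forall z,
      `|((fun x => (g x)%:E) \_ Om) (reindex_ffun (s z) x)| <= eps%:E.
    apply: (filter_forall (ae_filter_ringOfSetsType _)) => z.
    exact: (ae_reindex (st z) (ts z)
      (P := fun x => `|((fun x => (g x)%:E) \_ Om) x| <= eps%:E)).
  apply: (@filterS _ _ (ae_filter_ringOfSetsType _)) => x xP /=.
  rewrite /patch; case: ifPn => xO; last by rewrite abse0.
  rewrite lee_fin ger0_norm; last exact: (@ell_norm_ge0 _ +oo).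
  apply/bigmax_leP; split=> // z _; rewrite ffunE -lee_fin.
  by have := xP z; rewrite /patch mem_set// Om_s -in_setE.
rewrite lte_fin => r0 geps.
have r_neq0 : r != 0%R by rewrite gt_eqF.
pose k := fun x : lebesgueType R I => `|((fun x => (g x)%:E) \_ Om) x| `^ r.
have mk : measurable_fun setT k.
  apply: (@measurableT_comp _ _ _ _ _ _ (@poweR R ^~ r)).
    exact: measurable_poweR.
  apply: measurableT_comp => //.
  apply/(measurable_restrictT _ _).1 => //; apply: measurable_funTS.
  exact/measurable_EFinP.
have k0 x : 0 <= k x by exact: poweR_ge0.
rewrite (eq_integral (fun x : lebesgueType R I =>
  \sum_z k (reindex_ffun (s z) x))); last first.
  move=> x _; rewrite /k /patch; case: ifPn => xO; last first.
    rewrite abse0 poweR0r// big1// => z _.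
    rewrite memNset ?abse0 ?poweR0r//.
    by move=> /Om_s/mem_set; exact/negP.
  rewrite abse_EFin ger0_norm ?powR_ge0// poweR_EFin -powRrM mulVf//.
  rewrite powRr1; last by apply: sumr_ge0 => z _; exact: powR_ge0.
  rewrite -sumEFin; apply: eq_bigr => z _.
  by rewrite ffunE mem_set// Om_s -in_setE.
rewrite ge0_integral_sum//; last first.
  move=> z; exact: (measurableT_comp mk (measurable_reindex (st z) (ts z))).
rewrite (eq_bigr (fun=> \int[@lebesgue_ffun R I]_x k x)); last first.
  by move=> z _; apply: (ge0_integral_reindex (st z) (ts z)).
rewrite [X in X `^ _](_ : _ = (#|J|%:R)%:E * \int[@lebesgue_ffun R I]_x k x).
  rewrite poweRM ?integral_ge0 ?lee_fin// poweR_EFin EFinM.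
  by apply: lee_wpmul2l => //; rewrite lee_fin powR_ge0.
by rewrite sumr_const mule_natl.
Qed.

End LpNormLemmas.

Local Close Scope ereal_scope.

(** * Equivalence of the two approximation problems *)

Theorem theorem1p1 (R : realType) (d N : nat) (rho : R -> R)
    (F : stack R d N -> grid R d) (Omega : 'I_N -> set R)
    (mrho : measurable_fun [set: R] rho)
    (mF : lebesgue_measurable_fun F)
    (equivF : translation_equivariant F)
    (mOmega : forall m, completed_algebra_gen (@lebesgue_measure R) (Omega m))
    (p : \bar R) (p_gt0 : (0 < p)%E) (eps : R) (eps_ge0 : 0 <= eps) :
  (forall W L : nat,
    (exists Phi : fnn R ('I_N * pixel d)%type L,
      fnn_params Phi = W /\
      (Lp_norm p (pixel_box Omega)
        (fun X => (fnn_eval rho Phi X - pi0 (F X))%R) <= eps%:E)%E) ->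
    exists Psi : cnn R d N L,
      (cnn_params Psi <= 2 * W)%N /\
      (Lp_norm_vec p (pixel_box Omega)
        (fun X => (cnn_eval rho Psi X - F X)%R)
        <= (pow_2_over d.+1 p * eps)%R%:E)%E) /\
  (forall W L : nat,
    (exists Psi : cnn R d N L,
      cnn_params Psi = W /\
      (Lp_norm_vec p (pixel_box Omega)
        (fun X => (cnn_eval rho Psi X - F X)%R) <= eps%:E)%E) ->
    exists Phi : fnn R ('I_N * pixel d)%type L,
      (fnn_params Phi <= d.+1 ^ 4 * W)%N /\
      (Lp_norm p (pixel_box Omega)
        (fun X => (fnn_eval rho Phi X - pi0 (F X))%R) <= eps%:E)%E).
Proof.
(* [s z] is the permutation of the coordinates that induces S_{-z}. *)
pose s (z : pixel d) (mj : 'I_N * pixel d) := (mj.1, mj.2 - - z).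
pose t (z : pixel d) (mj : 'I_N * pixel d) := (mj.1, mj.2 - z).
have st z : cancel (s z) (t z) by move=> [m j]; rewrite /s /t/= opprK addrK.
have ts z : cancel (t z) (s z) by move=> [m j]; rewrite /s /t/= opprK subrK.
have shiftE z (X : stack R d N) : shift_stack (- z) X = reindex_ffun (s z) X.
  by apply/ffunP => mj; rewrite !ffunE.
split=> W L.
  case=> Phi [<- Phi_eps].
  have [Psi [Psin PsiE]] := cnn_of_fnn rho Phi.
  exists Psi; split=> //.
  pose g X := fnn_eval rho Phi X - pi0 (F X).
  have mg : measurable_fun [set: lebesgueType R ('I_N * pixel d)%type] g.
    apply: measurable_funB.
      apply: measurable_fnn_eval => // i; exact: measurable_coord.
    exact: (measurableT_comp (measurable_coord_borel (0, 0)) mF).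
  have box_shift z (X : stack R d N) :
      pixel_box Omega (reindex_ffun (s z) X) <-> pixel_box Omega X.
    split=> XO m j; last by rewrite ffunE; exact: XO.
    by have := XO m (j - z); rewrite ffunE /s/= opprK subrK.
  have := Lp_norm_vec_reindex st ts p_gt0 (measurable_pixel_box mOmega)
    box_shift mg eps_ge0 Phi_eps.
  rewrite (_ : (fun X => [ffun z => g (reindex_ffun (s z) X)]) =
    (fun X => cnn_eval rho Psi X - F X)).
    congr (_ <= _%:E)%E; congr (_ * _); rewrite /pow_2_over.
    case: p p_gt0 {Phi_eps} => // r _.
    by rewrite card_prod card_ord natrM powRrM powR_mulrn// expr2.
  apply/funext => X; apply/ffunP => z.
  rewrite ffunE [RHS]ffunE [X in _ = _ + X]ffunE PsiE /g shiftE; congr (_ - _).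
  by rewrite -shiftE equivF /pi0 ffunE opprK add0r.
case=> Psi [<- Psi_eps].
have [Phi [Phin PhiE]] := fnn_of_cnn rho Psi.
exists Phi; split=> //; apply: le_trans Psi_eps.
apply: le_Lp_norm => // X; rewrite PhiE.
rewrite [leRHS]ger0_norm ?ell_norm_ge0//.
by have := ler_ell_norm (cnn_eval rho Psi X - F X) (0, 0) p_gt0; rewrite !ffunE.
Qed.
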